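(* Let $S\subset\mathbb{R}^2$ be a finite set of distinct points with $|S|$ even. Alice wins if and only if all the perfect lines are concurrent, i.e. there is a point $x\in\mathbb{R}^2$ lying on every perfect line. In this case, such a common point $x$ is a winning point for Alice.
   Context: The game: Alice chooses $a\in\mathbb{R}^2$; then Bob, knowing $a$, chooses $b\in\mathbb{R}^2$. With $\rho$ the Euclidean distance, $V_A=|\{y\in S:\rho(a,y)<\rho(b,y)\}|$ and $V_B=|\{y\in S:\rho(b,y)<\rho(a,y)\}|$. A point $a$ is a winning point for Alice if $V_A\ge V_B$ for every $b$; Alice wins if a winning point exists. When $|S|$ is even, a line $l$ is perfect if each of the two open half-planes bounded by $l$ contains fewer than $|S|/2$ points of $S$.
   Formalization: ''Such a common point x is a winning point'' is proved for every common point when S is empty or not collinear; for nonempty collinear S, where it fails (S={(0,0),(1,0)}, x=(5,0), Bob plays (4,0)), only that some common point is winning is proved. *)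

(* Defs.v *)
From mathcomp Require Export all_boot all_order all_algebra.
From mathcomp Require Export finmap.
From mathcomp Require Export reals.

Set Implicit Arguments.
Unset Strict Implicit.
Unset Printing Implicit Defensive.

Import Order.TTheory GRing.Theory Num.Theory.
Local Open Scope ring_scope.
Local Open Scope fset_scope.

(* The library norm on 'rV[R]_2 is the sup norm, hence the explicit formula. *)
Definition rho (R : realType) (u v : 'rV[R]_2) : R :=
  Num.sqrt (\sum_(i < 2) (u 0 i - v 0 i) ^+ 2).

Definition votes (R : realType) (S : {fset 'rV[R]_2}) (p q : 'rV[R]_2) : nat :=
  #|` [fset y in S | rho p y < rho q y]|.

(* V_A = votes S a b and V_B = votes S b a. *)
Definition winning_point (R : realType) (S : {fset 'rV[R]_2})
    (a : 'rV[R]_2) : Prop :=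
  forall b : 'rV[R]_2, (votes S b a <= votes S a b)%N.

Definition alice_wins (R : realType) (S : {fset 'rV[R]_2}) : Prop :=
  exists a : 'rV[R]_2, winning_point S a.

(* A line given by an equation normal . y = offset. Proportional equations give
   the same line and, up to exchange, the same two open half-planes. *)
Record line (R : realType) := Line {
  normal : 'rV[R]_2;
  offset : R;
  normal_neq0 : normal != 0
}.

Definition line_form (R : realType) (l : line R) (y : 'rV[R]_2) : R :=
  (\sum_(i < 2) normal l 0 i * y 0 i) - offset l.

Definition on_line (R : realType) (l : line R) (y : 'rV[R]_2) : bool :=
  line_form l y == 0.

(* The points of S in each of the two open half-planes bounded by l. *)
Definition neg_side (R : realType) (S : {fset 'rV[R]_2}) (l : line R) :=
  [fset y in S | line_form l y < 0].

Definition pos_side (R : realType) (S : {fset 'rV[R]_2}) (l : line R) :=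
  [fset y in S | 0 < line_form l y].

(* "k < |S|/2" is written k.*2 < |S|, which is exact for every |S|. *)
Definition perfect (R : realType) (S : {fset 'rV[R]_2}) (l : line R) : bool :=
  ((#|` neg_side S l|).*2 < #|` S|)%N && ((#|` pos_side S l|).*2 < #|` S|)%N.

Definition on_all_perfect_lines (R : realType) (S : {fset 'rV[R]_2})
    (x : 'rV[R]_2) : Prop :=
  forall l : line R, perfect S l -> on_line l x.

(* If S is nonempty, of even size and collinear, its carrier is the only perfect
   line, and a point of the carrier need not be winning (take an outer one):
   "the common point is winning" can hold for all common points only when S is
   empty or not collinear. *)
Definition collinear (R : realType) (S : {fset 'rV[R]_2}) : Prop :=
  exists l : line R, forall y, y \in S -> on_line l y.

(* Main.v *)
(** Bob's possible gains are the open half-planes missing a, so a is winning iff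
    every closed half-plane with a on its boundary contains at least half of S.
    Such a deep point is on every perfect line.

    Conversely let x be on all perfect lines, let S be noncollinear of size 2k, and
    suppose that fewer than k points p satisfy u.p <= u.x. Then no perfect line has
    normal u, so the k lowest points K of S in the direction u lie strictly below
    the others. Rotating u either way, K remains a set of k lowest points until the
    first perfect normal, where K lies weakly below a line through x. Since there
    are two nonparallel perfect normals, these two events occur less than a half
    turn apart, hence u is a positive combination of the two normals and K lies
    weakly below x in the direction u as well: a contradiction.

    When S is nonempty and collinear, a median point is deep. *)
Require Import Defs.
From mathcomp Require Import boolp ring lra zify.
Set Implicit Arguments.
Unset Strict Implicit.
Unset Printing Implicit Defensive.

Import Order.TTheory GRing.Theory Num.Theory.
Local Open Scope ring_scope.

(** * Minimizers, counts and medians in sequences *)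

Lemma seq_argmin (R : realDomainType) (T : eqType) (f : T -> R) (P : pred T)
    (s : seq T) (x : T) :
  x \in s -> P x ->
  exists m, [/\ m \in s, P m & forall y, y \in s -> P y -> f m <= f y].
Proof.
elim: s x => // z s IH x xs Px.
case: (boolP (has P s)) => [/hasP[y ys Py]|/hasPn nP].
  have [m [ms Pm mmin]] := IH y ys Py.
  case: (boolP (P z && (f z <= f m))) => [/andP[Pz zm]|nz].
    exists z; split; rewrite ?mem_head // => w; rewrite in_cons.
    by case/predU1P => [-> //|ws Pw]; rewrite (le_trans zm) ?mmin.
  exists m; split; rewrite ?in_cons ?ms ?orbT // => w.
  case/predU1P => [-> Pz|ws Pw]; last exact: mmin.
  by move: nz; rewrite Pz /= -ltNge => /ltW.
exists x; split=> // w; rewrite in_cons => /predU1P[->|/nP /negP //] Pz.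
by move: xs Px; rewrite in_cons => /predU1P[-> //|/nP /negP].
Qed.

Lemma sub_count_in (T : eqType) (P Q : pred T) (s : seq T) :
  {in s, subpred P Q} -> (count P s <= count Q s)%N.
Proof.
elim: s => //= z s IH PQ; rewrite leq_add ?IH //.
  by have := PQ z (mem_head _ _); case: (P z) => // ->.
by move=> y ys; apply: PQ; rewrite in_cons ys orbT.
Qed.

Lemma count_lt_in (T : eqType) (P Q : pred T) (s : seq T) (x : T) :
  {in s, subpred P Q} -> x \in s -> Q x -> ~~ P x ->
  (count P s < count Q s)%N.
Proof.
elim: s => // z s IH PQ; rewrite in_cons => /predU1P[->|xs] Qx nPx /=.
  rewrite Qx (negbTE nPx) add0n add1n ltnS sub_count_in // => y ys.
  by apply: PQ; rewrite in_cons ys orbT.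
rewrite -addnS leq_add //.
  by have := PQ z (mem_head _ _); case: (P z) => // ->.
by apply: IH => // y ys; apply: PQ; rewrite in_cons ys orbT.
Qed.

(** Take [m] of least value among the entries with at least [k] entries weakly below. If [k] entries
    lay strictly below [m], the greatest of these would have the same property at a smaller
    value. *)
Lemma seq_median (R : realDomainType) (T : eqType) (f : T -> R) (s : seq T)
    (k : nat) :
  (0 < k <= size s)%N ->
  exists m, [/\ m \in s, (k <= count (fun y => (f y <= f m)%R) s)%N
    & (count (fun y => (f y < f m)%R) s < k)%N].
Proof.
move=> /andP[k0 ks].
have /hasP[x0 x0s _] : has predT s by rewrite has_predT (leq_trans k0).
have [M [Ms _ Mmax]] := @seq_argmin R T (fun y => - f y) predT s x0 x0s isT.
pose P y := (k <= count (fun z => (f z <= f y)%R) s)%N.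
have PM : P M.
  rewrite /P (_ : count _ s = size s) //; apply/eqP; rewrite -all_count.
  by apply/allP => y ys; rewrite -lerN2 Mmax.
have [m [ms Pm mmin]] := @seq_argmin R T f P s M Ms PM.
exists m; split=> //; rewrite ltnNge; apply/negP => kc.
have /hasP[y ys ym] : has (fun y => (f y < f m)%R) s.
  by rewrite has_count (leq_trans k0).
have [b [bs bm bmax]] := @seq_argmin R T (fun y => - f y)
  (fun y => (f y < f m)%R) s y ys ym.
have Pb : P b.
  apply: leq_trans kc _; apply: sub_count_in => z zs zm.
  by rewrite -lerN2 bmax.
by have := mmin b bs Pb; rewrite leNgt bm.
Qed.

(** * Dot and cross products in the plane *)

Section Plane.
Variable R : realType.
Implicit Types (u v w x y p q : 'rV[R]_2) (s : seq 'rV[R]_2) (t : R).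

Definition dot u y : R := \sum_(i < 2) u 0 i * y 0 i.

Definition cross u v : R := u 0 0 * v 0 1 - u 0 1 * v 0 0.

Definition perp u : 'rV[R]_2 := \row_(i < 2) (if i == 0 then - u 0 1 else u 0 0).

Lemma sum_ord2 (F : 'I_2 -> R) : \sum_(i < 2) F i = F 0 + F 1.
Proof.
by rewrite big_ord_recl big_ord1; congr (_ + F _); apply/val_inj.
Qed.

Lemma dotE u y : dot u y = u 0 0 * y 0 0 + u 0 1 * y 0 1.
Proof. exact: sum_ord2. Qed.

Lemma dotDl u v y : dot (u + v) y = dot u y + dot v y.
Proof. by rewrite !dotE !mxE; ring. Qed.

Lemma dotZl c u y : dot (c *: u) y = c * dot u y.
Proof. by rewrite !dotE !mxE; ring. Qed.

Lemma dotNl u y : dot (- u) y = - dot u y.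
Proof. by rewrite !dotE !mxE; ring. Qed.

Lemma dot_cross u v w y :
  cross v w * dot u y = cross u w * dot v y + cross v u * dot w y.
Proof. by rewrite !dotE /cross; ring. Qed.

Lemma row2P u v : u 0 0 = v 0 0 -> u 0 1 = v 0 1 -> u = v.
Proof.
move=> uv0 uv1; apply/rowP => -[[|[|//]] i].
  by rewrite (_ : Ordinal i = 0) //; apply/val_inj.
by rewrite (_ : Ordinal i = 1) //; apply/val_inj.
Qed.

(** Cramer's rule; [dot_cross] is the same identity paired with [y]. *)
Lemma vec_cross u v w :
  cross v w *: u = cross u w *: v + cross v u *: w.
Proof. by apply: row2P; rewrite !mxE /cross; ring. Qed.

Lemma row2_neq0 u : (u != 0) = (u 0 0 != 0) || (u 0 1 != 0).
Proof.
rewrite -negb_and; congr (~~ _); apply/eqP/andP => [->|[/eqP u0 /eqP u1]].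
  by rewrite !mxE eqxx.
by apply: row2P; rewrite mxE.
Qed.

Lemma cross_perp u : cross (perp u) u = - dot u u.
Proof. by rewrite /cross dotE !mxE /=; ring. Qed.

Lemma dot_gt0 u : u != 0 -> 0 < dot u u.
Proof.
rewrite row2_neq0 dotE -!expr2 => /orP[] h.
  by rewrite ltr_pwDl ?sqr_ge0 // exprn_even_gt0.
by rewrite ltr_wpDl ?sqr_ge0 // exprn_even_gt0.
Qed.

Lemma cross_neq0 u v : cross u v != 0 -> u != 0.
Proof. by apply: contra_neq => ->; rewrite /cross !mxE; ring. Qed.


(** * Perfect lines as balanced levels of a linear form *)

(** Perfection for a sequence and a possibly zero normal, so that a turning normal carries no
    proof. *)
Definition balanced s u t : bool :=
  ((count (fun y => (dot u y < t)%R) s).*2 < size s)%N &&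
  ((count (fun y => (t < dot u y)%R) s).*2 < size s)%N.

(** A negative factor only exchanges the two sides; this later absorbs the signs of coefficients. *)
Lemma balancedZ s c u t : c != 0 -> balanced s u t -> balanced s (c *: u) (c * t).
Proof.
rewrite /balanced; case: (ltgtP c 0) => // c0 _ /andP[lo hi]; apply/andP; split.
- by rewrite (eq_count (a2 := fun y => t < dot u y)) // => y; rewrite dotZl ltr_nM2l.
- by rewrite (eq_count (a2 := fun y => dot u y < t)) // => y; rewrite dotZl ltr_nM2l.
- by rewrite (eq_count (a2 := fun y => dot u y < t)) // => y; rewrite dotZl ltr_pM2l.
- by rewrite (eq_count (a2 := fun y => t < dot u y)) // => y; rewrite dotZl ltr_pM2l.
Qed.

Lemma balancedN s u t : balanced s u t -> balanced s (- u) (- t).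
Proof.
by move=> /(@balancedZ _ (-1)); rewrite scaleN1r mulN1r oppr_eq0 oner_neq0; apply.
Qed.

(** * Lower halves and their rotation to a balanced normal *)

Section Even.
Variables (s : seq 'rV[R]_2) (k : nat).
Hypothesis size_s : size s = k.*2.

Lemma exists_median u : (0 < k)%N ->
  exists m, [/\ m \in s, (k <= count (fun y => (dot u y <= dot u m)%R) s)%N
    & (count (fun y => (dot u y < dot u m)%R) s < k)%N].
Proof.
by move=> kpos; apply: seq_median; rewrite kpos size_s -addnn leq_addr.
Qed.

Lemma count_predC_half (K : pred 'rV[R]_2) :
  count K s = k -> count (predC K) s = k.
Proof. by have := count_predC K s; lia. Qed.

(** [K] does not depend on [u], so one half can be followed as the direction turns. Ties are allowed
    because they occur at the first contact. *)
Definition lower_half (K : pred 'rV[R]_2) u :=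
  forall p q, p \in s -> q \in s -> K p -> ~~ K q -> dot u p <= dot u q.

Definition strict_lower_half (K : pred 'rV[R]_2) u :=
  forall p q, p \in s -> q \in s -> K p -> ~~ K q -> dot u p < dot u q.

(** At least [k] points lie weakly below a median; were there more, fewer than [k] would lie above
    it and its level would be balanced. *)
Lemma exists_strict_lower_half u :
  (forall t, ~~ balanced s u t) ->
  exists2 K : pred 'rV[R]_2, count K s = k & strict_lower_half K u.
Proof.
move=> nbal; have [k0|kpos] := posnP k.
  exists pred0; first by rewrite count_pred0 k0.
  by [].
have [m [ms mk mlt]] := exists_median u kpos.
exists (fun y => dot u y <= dot u m); last first.
  by move=> p q _ _ /= pm; rewrite -ltNge; apply: le_lt_trans.
have := nbal (dot u m); rewrite /balanced negb_and.
have := count_predC (fun y => dot u y <= dot u m) s.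
rewrite (eq_count (a1 := predC _) (a2 := fun y => dot u m < dot u y)); last first.
  by move=> y /=; rewrite ltNge.
by rewrite size_s; lia.
Qed.

(** The common level of [p] and [q] is the top of [K] and the bottom of its complement: the points
    strictly below lie in [K] and miss [p], those strictly above lie outside and miss [q]. *)
Lemma contact_balanced (K : pred 'rV[R]_2) u p q :
    count K s = k -> lower_half K u ->
    p \in s -> q \in s -> K p -> ~~ K q -> dot u p = dot u q ->
  balanced s u (dot u p).
Proof.
move=> cK Ku ps qs Kp nKq pq; rewrite /balanced size_s !ltn_double.
apply/andP; split.
  rewrite -[X in (_ < X)%N]cK; apply: (count_lt_in (x := p)); rewrite ?ltxx //.
  move=> y ys; rewrite pq; case: (boolP (K y)) => // nKy.
  by rewrite ltNge -pq Ku.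
rewrite -[X in (_ < X)%N](count_predC_half cK).
apply: (count_lt_in (x := q)); rewrite ?pq ?ltxx //.
move=> y ys /=; case: (boolP (K y)) => // Ky.
by rewrite ltNge Ku.
Qed.

(** If [p] were above [t], so would be all [k] points outside [K]. *)
Lemma lower_half_balanced (K : pred 'rV[R]_2) u t p :
    count K s = k -> lower_half K u -> balanced s u t ->
    p \in s -> K p -> dot u p <= t.
Proof.
move=> cK Ku /andP[_]; rewrite size_s ltn_double => hi ps Kp.
rewrite leNgt; apply/negP => tp; move: hi; apply/negP; rewrite -leqNgt.
rewrite -[X in (X <= _)%N](count_predC_half cK).
by apply: sub_count_in => q qs /= nKq; apply: lt_le_trans tp _; apply: Ku.
Qed.

Lemma first_crossing (K : pred 'rV[R]_2) u v p q :
    count K s = k -> strict_lower_half K u ->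
    p \in s -> q \in s -> K p -> ~~ K q -> dot (u + v) q <= dot (u + v) p ->
  exists r t, [/\ 0 < r <= 1, lower_half K (u + r *: v)
    & balanced s (u + r *: v) t].
Proof.
move=> cK Ku ps qs Kp nKq cross_pq.
(* The pair [z] meets at time [A z / - B z]; take the earliest such pair. *)
pose A (z : 'rV[R]_2 * 'rV[R]_2) := dot u z.2 - dot u z.1.
pose B (z : 'rV[R]_2 * 'rV[R]_2) := dot v z.2 - dot v z.1.
(* Only pairs that tie or swap by time 1 compete: there [A] is positive, so [B] is negative and the
   quotient is a positive time at most 1. *)
pose P (z : 'rV[R]_2 * 'rV[R]_2) := [&& K z.1, ~~ K z.2 & A z + B z <= 0].
pose prs := [seq (a, b) | a <- s, b <- s].
have [||[a b] [/allpairsP[[a' b'] /= [as_ bs [? ?]]] /and3P[/= Ka nKb AB] zmin]] :=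
  @seq_argmin R _ (fun z => A z / - B z) P prs (p, q).
- by apply/allpairsP; exists (p, q).
- by rewrite /P /A /B /= Kp nKq /=; move: cross_pq; rewrite !dotDl; lra.
subst a' b'.
have Aab : 0 < A (a, b) by rewrite /A subr_gt0 Ku.
have Bab : 0 < - B (a, b) by lra.
set r := A (a, b) / - B (a, b) in zmin.
have r0 : 0 < r by rewrite divr_gt0.
have r1 : r <= 1 by rewrite ler_pdivrMr // mul1r; lra.
have rAB : A (a, b) + r * B (a, b) = 0.
  by rewrite /r; field; rewrite -oppr_eq0 gt_eqF.
have Kr : lower_half K (u + r *: v).
  move=> c d cs ds Kc nKd; rewrite !dotDl !dotZl.
  have Acd : 0 < A (c, d) by rewrite /A subr_gt0 Ku.
  suff : 0 <= A (c, d) + r * B (c, d) by rewrite /A /B /=; lra.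
  (* An affine gap positive at times 0 and 1 is positive in between; the other pairs tie no earlier
     than [r]. *)
  have [ABcd|ABcd] := leP (A (c, d) + B (c, d)) 0; last by nra.
  have Bcd : 0 < - B (c, d) by lra.
  have := zmin (c, d); rewrite /P /= Kc nKd ABcd ler_pdivlMr //.
  have -> : (c, d) \in prs by apply/allpairsP; exists (c, d).
  by move=> /(_ isT isT); lra.
exists r, (dot (u + r *: v) a); split; rewrite ?r0 //.
apply: (@contact_balanced K _ a b) => //.
by move: rAB; rewrite !dotDl !dotZl /A /B /=; lra.
Qed.

(* Otherwise [K] stays the lower half along all of [perp w + r *: w], and
   letting [r] tend to both infinities, [w] is constant on [s]. *)
Lemma exists_transverse_balanced w :
    w != 0 -> (0 < k)%N -> (forall t, exists2 y, y \in s & dot w y != t) ->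
  exists u t, cross u w != 0 /\ balanced s u t.
Proof.
move=> w0 kpos ncol; apply: contrapT => none.
have nb u t : cross u w != 0 -> ~~ balanced s u t.
  by move=> uw; apply/negP => b; apply: none; exists u, t.
pose u0 := perp w.
have u0w : cross u0 w != 0 by rewrite cross_perp oppr_eq0 gt_eqF ?dot_gt0.
have crossr r : cross (u0 + r *: w) w = cross u0 w.
  by rewrite /cross !mxE; ring.
have [K cK Ku] := @exists_strict_lower_half u0 (fun t => nb _ _ u0w).
have eqw p q : p \in s -> q \in s -> K p -> ~~ K q -> dot w p = dot w q.
  move=> ps qs Kp nKq; apply/eqP; apply: contrapT => /negP pq.
  have d0 : dot w p - dot w q != 0 by rewrite subr_eq0.
  (* This [c] makes [p] and [q] tie in direction [u0 + c *: w]; the balanced normal met on the way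
     is transverse to [w], against [nb]. *)
  pose c := (dot u0 q - dot u0 p) / (dot w p - dot w q).
  have [|r [t [_ _]]] := @first_crossing K u0 (c *: w) p q cK Ku ps qs Kp nKq.
    rewrite !dotDl !dotZl -subr_ge0 (_ : _ - _ = 0) // /c.
    by field.
  by apply/negP; rewrite scalerA; apply: nb; rewrite crossr.
have /hasP[p ps Kp] : has K s by rewrite has_count cK.
have /hasP[q qs nKq] : has (predC K) s.
  by rewrite has_count (count_predC_half cK).
have [y ys /eqP[]] := ncol (dot w p).
case: (boolP (K y)) => Ky; last exact/esym/eqw.
by rewrite (eqw y q) // (eqw p q).
Qed.

(* [r |-> dot (u + r *: v) (p - x)] is positive at 0 and nonpositive at the
   first crossing. *)
Lemma crossing_drops_lower_half x u v (K : pred 'rV[R]_2) p t :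
    (forall w t', w != 0 -> balanced s w t' -> dot w x = t') ->
    count K s = k -> strict_lower_half K u -> cross u v != 0 ->
    balanced s (u + v) t -> p \in s -> K p -> dot u x < dot u p ->
  dot v p < dot v x.
Proof.
move=> xall cK Ku uv bt ps Kp xp.
have nz r : u + r *: v != 0.
  apply: (@cross_neq0 _ v); rewrite (_ : cross _ _ = cross u v) //.
  by rewrite /cross !mxE; ring.
have [r [t' [/andP[r0 r1] Kr br]]] : exists r t', [/\ 0 < r <= 1,
    lower_half K (u + r *: v) & balanced s (u + r *: v) t'].
  (* Either [K] is still a lower half at [u + v], balanced by hypothesis, or an exchanged pair
     forces a crossing by then. *)
  have [Kuv|] := pselect (lower_half K (u + v)).
    by exists 1, t; rewrite scale1r ltr01 lexx.
  move=> /existsNP[a /existsNP[b]].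
  move=> /not_implyP[as_ /not_implyP[bs /not_implyP[Ka /not_implyP[nKb]]]].
  move=> /negP; rewrite -ltNge => /ltW ab.
  exact: (@first_crossing K u v a b).
have := lower_half_balanced cK Kr br ps Kp.
by rewrite -(xall _ _ (nz r) br) !dotDl !dotZl; nra.
Qed.

(** * Deep points and balanced levels *)

Lemma on_balanced_depth x :
    (forall w t, w != 0 -> balanced s w t -> dot w x = t) ->
    (forall w t, w != 0 -> exists2 y, y \in s & dot w y != t) ->
  forall u, (k <= count (fun y => (dot u y <= dot u x)%R) s)%N.
Proof.
move=> xall ncol u; rewrite leqNgt; apply/negP => shallow.
have kpos : (0 < k)%N by apply: leq_ltn_trans shallow.
have u0 : u != 0.
  apply: contraTneq shallow => ->; rewrite -leqNgt.
  rewrite (eq_count (a2 := predT)) ?count_predT ?size_s -?addnn ?leq_addr //.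
  by move=> y; rewrite !dotE !mxE !mul0r lexx.
(* A balanced level would pass through [x], leaving fewer than [k] points above it and so more than
   [k] weakly below. *)
have nb t : ~~ balanced s u t.
  apply/negP => b; have xt := xall _ _ u0 b; move: b; rewrite -xt.
  case/andP => _; have := count_predC (fun y => dot u y <= dot u x) s.
  rewrite (eq_count (a1 := predC _) (a2 := fun y => dot u x < dot u y)); last first.
    by move=> y /=; rewrite ltNge.
  by rewrite size_s; lia.
have [K cK Ku] := @exists_strict_lower_half u nb.
have [p ps /andP[Kp xp]] :
    exists2 p, p \in s & K p && (dot u x < dot u p).
  apply/hasP; apply: contraTT shallow => /hasPn nK.
  rewrite -leqNgt -[X in (X <= _)%N]cK; apply: sub_count_in => y ys Ky.
  by have := nK y ys; rewrite Ky /= -leNgt.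
(* [w1] is transverse to [u] and [w2] to [w1], so [u] has coordinates in this basis of balanced
   normals. *)
have [w1 [t1 [w1u b1]]] := exists_transverse_balanced u0 kpos (fun t => ncol u t u0).
have w10 := cross_neq0 w1u.
have [w2 [t2 [w2w1 b2]]] :=
  exists_transverse_balanced w10 kpos (fun t => ncol w1 t w10).
pose D := cross w2 w1.
pose c2 := cross u w1 / D; pose c1 := cross w2 u / D.
have uE : u = c1 *: w1 + c2 *: w2.
  apply: (scalerI (a := D)) => //; rewrite vec_cross scalerDr !scalerA addrC.
  by rewrite /c1 /c2; congr (_ *: _ + _ *: _); field.
have c20 : c2 != 0.
  rewrite mulf_neq0 ?invr_eq0 //; apply: contraNneq w1u.
  by rewrite /cross => h; apply/eqP; lra.
(* Otherwise [u] would be a multiple of the balanced normal [w2]. *)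
have c10 : c1 != 0.
  apply: contraNneq (nb (c2 * t2)) => c10.
  by rewrite uE c10 scale0r add0r balancedZ.
clearbody c1 c2.
have two0 : 2%:R != 0 :> R by rewrite pnatr_eq0.
(* Now [u + v] and [u - v] are twice [c2 *: w2] and [c1 *: w1], hence balanced normals; moving along
   [v] and along [- v] gives opposite strict inequalities. *)
pose v := c2 *: w2 - c1 *: w1.
have uv : cross u v != 0.
  rewrite (_ : cross u v = - (2%:R * c1 * c2 * D)).
    by rewrite oppr_eq0 !mulf_eq0 (negbTE two0) (negbTE c10) (negbTE c20) (negbTE w2w1).
  by rewrite uE /v /cross /D !mxE /cross; ring.
have bp : balanced s (u + v) (2%:R * (c2 * t2)).
  rewrite (_ : u + v = 2%:R *: (c2 *: w2)); first by rewrite !balancedZ.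
  by rewrite uE /v; apply: row2P; rewrite !mxE; ring.
have bm : balanced s (u - v) (2%:R * (c1 * t1)).
  rewrite (_ : u - v = 2%:R *: (c1 *: w1)); first by rewrite !balancedZ.
  by rewrite uE /v; apply: row2P; rewrite !mxE; ring.
have h1 := crossing_drops_lower_half xall cK Ku uv bp ps Kp xp.
have uNv : cross u (- v) != 0.
  by apply: contraNneq uv; rewrite /cross !mxE => h; apply/eqP; lra.
have := crossing_drops_lower_half xall cK Ku uNv bm ps Kp xp.
by rewrite !dotNl; lra.
Qed.

(** If [x] were below a balanced level, the [k] points weakly below [x] would lie strictly below
    that level. This is applied to [u] and to [- u]. *)
Lemma depth_on_balanced x u t :
    (forall u, (k <= count (fun y => (dot u y <= dot u x)%R) s)%N) ->
  balanced s u t -> dot u x = t.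
Proof.
move=> deep b.
have nle w t' : balanced s w t' -> t' <= dot w x.
  move=> /andP[+ _]; rewrite size_s ltn_double leNgt => lo; apply/negP => xt.
  move: lo; apply/negP; rewrite -leqNgt; apply: leq_trans (deep w) _.
  by apply: sub_count_in => y ys yx; apply: le_lt_trans xt.
apply/le_anti; rewrite nle // andbT.
by have := nle _ _ (balancedN b); rewrite dotNl lerN2.
Qed.

(** A closed half-plane with the median [x] on its boundary contains one of the two rays from [x] on
    the carrier, and each ray has at least [k] points. *)
Lemma collinear_depth w t :
    w != 0 -> (0 < k)%N -> (forall y, y \in s -> dot w y = t) ->
  exists x, forall u, (k <= count (fun y => (dot u y <= dot u x)%R) s)%N.
Proof.
move=> w0 kpos col; pose d := perp w.
have [x [xs xk xlt]] := exists_median d kpos.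
exists x => u.
have D0 : cross w d != 0.
  by rewrite /cross !mxE /= mulrN opprK -dotE gt_eqF ?dot_gt0.
(* On the carrier [dot u] is affine in [dot d]; the sign of [cross w d * cross w u] selects the
   ray. *)
have key y : y \in s ->
    cross w d ^+ 2 * (dot u y - dot u x) =
    (cross w d * cross w u) * (dot d y - dot d x).
  move=> ys; have := dot_cross u w d x; have := dot_cross u w d y.
  rewrite !col // => ey ex; rewrite expr2 -!mulrA !mulrBr ey ex.
  by ring.
have DD : 0 < cross w d ^+ 2 by rewrite exprn_even_gt0.
have [e0|e0] := leP 0 (cross w d * cross w u).
  apply: leq_trans xk _; apply: sub_count_in => y ys yx.
  by rewrite -subr_le0 -(pmulr_rle0 _ DD) key // mulr_ge0_le0 // subr_le0.
suff : (count (predC (fun y => (dot d y < dot d x)%R)) s <=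
        count (fun y => (dot u y <= dot u x)%R) s)%N.
  have := count_predC (fun y => dot d y < dot d x) s.
  by move: xlt; rewrite size_s; lia.
apply: sub_count_in => y ys /=; rewrite -leNgt => xy.
by rewrite -subr_le0 -(pmulr_rle0 _ DD) key // mulr_le0_ge0 ?subr_ge0 // ltW.
Qed.

End Even.

(** * Votes, perfect lines and winning points as counts *)

(** After squaring, the terms quadratic in [y] cancel; for distinct [a] and [b] the boundary is
    their perpendicular bisector. *)
Lemma rho_lt (a b y : 'rV[R]_2) :
  (rho a y < rho b y) = (dot (b - a) y < (dot b b - dot a a) / 2%:R).
Proof.
rewrite ltNge ler_sqrt ?sumr_ge0 //; last by move=> i _; rewrite sqr_ge0.
by rewrite -ltNge !sum_ord2 !dotE !mxE; apply/idP/idP; nra.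
Qed.

Lemma card_fset_filter (T : choiceType) (S : {fset T}) (P : pred T) :
  #|` [fset y in S | P y]%fset| = count P S.
Proof.
rewrite -size_filter; apply/perm_size/uniq_perm.
- exact: fset_uniq.
- exact/filter_uniq/fset_uniq.
- by move=> y; rewrite mem_filter !inE andbC.
Qed.

Lemma perfectE (S : {fset 'rV[R]_2}) (l : line R) :
  perfect S l = balanced S (normal l) (offset l).
Proof.
rewrite /perfect /neg_side /pos_side !card_fset_filter /balanced /line_form.
congr (((_.*2) < _) && ((_.*2) < _))%N; apply: eq_count => y.
  by rewrite subr_lt0.
by rewrite subr_gt0.
Qed.

Lemma on_all_perfect_linesE (S : {fset 'rV[R]_2}) x :
  on_all_perfect_lines S x <->
  forall u t, u != 0 -> balanced S u t -> dot u x = t.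
Proof.
split=> [xall u t u0 b|xall l].
  by apply/eqP; rewrite -subr_eq0; apply: (xall (Line t u0)); rewrite perfectE.
by rewrite perfectE => /(xall _ _ (normal_neq0 l)) xl; rewrite /on_line subr_eq0; apply/eqP.
Qed.

Lemma votesE (S : {fset 'rV[R]_2}) (a b : 'rV[R]_2) :
  votes S a b =
  count (fun y => (dot (b - a) y < (dot b b - dot a a) / 2%:R)%R) S.
Proof. by rewrite /votes card_fset_filter; apply: eq_count => y; rewrite rho_lt. Qed.

Lemma votes_gtE (S : {fset 'rV[R]_2}) (a b : 'rV[R]_2) :
  votes S b a =
  count (fun y => ((dot b b - dot a a) / 2%:R < dot (b - a) y)%R) S.
Proof.
rewrite votesE; apply: eq_count => y.
by rewrite -opprB dotNl -(opprB (dot b b)) mulNr ltrN2.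
Qed.

Lemma winning_pointP (S : {fset 'rV[R]_2}) k a : size S = k.*2 ->
  winning_point S a <->
  forall u, (k <= count (fun y => (dot u y <= dot u a)%R) S)%N.
Proof.
move=> size_S; split=> [win u|deep b]; last first.
  rewrite (votesE S a b) (votes_gtE S a b).
  set u := b - a; set t := (dot b b - dot a a) / 2%:R.
  have [ba|ba] := eqVneq u 0.
    have d0 y : dot u y = 0 by rewrite ba dotE !mxE !mul0r addr0.
    have -> : t = 0 by rewrite /t (subr0_eq ba) subrr mul0r.
    by apply: sub_count_in => y _; rewrite d0 ltxx.
  (* The gap [t - dot u a] is half the squared distance from [a] to [b]. *)
  have ut : dot u a < t.
    have := dot_gt0 ba; rewrite /t ltr_pdivlMr ?ltr0n // !dotE !mxE; lra.
  have ht : (k <= count (fun y => (dot u y < t)%R) S)%N.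
    apply: leq_trans (deep u) _; apply: sub_count_in => y _.
    by move=> /le_lt_trans; apply.
  have := count_predC (fun y => dot u y < t) S.
  have : (count (fun y => (t < dot u y)%R) S <=
          count (predC (fun y => (dot u y < t)%R)) S)%N.
    by apply: sub_count_in => y _ /= /ltW; rewrite leNgt.
  by move: ht; rewrite size_S; lia.
rewrite leqNgt; apply/negP => shallow.
have cC := count_predC (fun y => dot u y <= dot u a) S.
have /hasP[y yS /=] : has (predC (fun y => (dot u y <= dot u a)%R)) S.
  by rewrite has_count; move: cC shallow; rewrite size_S; lia.
rewrite -ltNge => ay.
(* No point of [S] lies strictly between the levels of [a] and [m], so a bisector between them gives
   Bob exactly the points above [a]. *)
have [m [mS am mmin]] := @seq_argmin R _ (dot u) (fun y => dot u a < dot u y)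
  S y yS ay.
have u0 : u != 0.
  by apply: contraTneq ay => ->; rewrite !dotE !mxE !mul0r ltxx.
have uu := dot_gt0 u0.
pose t := (dot u a + dot u m) / 2%:R.
have [at_ tm] : dot u a < t /\ t < dot u m.
  by rewrite /t; split; lra.
pose c := 2%:R * (t - dot u a) / dot u u.
have c0 : 0 < c by rewrite divr_gt0 // mulr_gt0 ?ltr0n // subr_gt0.
have cu : c * dot u u = 2%:R * (t - dot u a) by rewrite /c divfK // gt_eqF.
(* This [b] puts the bisector of [a] and [b] at [dot u y = t]. *)
pose b := a + c *: u.
have ba : b - a = c *: u by rewrite /b addrC addKr.
have offE : (dot b b - dot a a) / 2%:R = c * t.
  suff -> : dot b b = dot a a + c * (2%:R * dot u a + c * dot u u).
    by rewrite cu; field.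
  by rewrite /b !dotE !mxE; ring.
have votes_ab : votes S a b = count (fun y => (dot u y <= dot u a)%R) S.
  rewrite votesE ba offE; apply: eq_in_count => z zS; rewrite dotZl ltr_pM2l //.
  apply/idP/idP => [zt|/le_lt_trans]; last exact.
  rewrite leNgt; apply/negP => /(mmin z zS) mz.
  by have := lt_trans zt (lt_le_trans tm mz); rewrite ltxx.
have votes_ba :
    votes S b a = count (predC (fun y => (dot u y <= dot u a)%R)) S.
  rewrite votes_gtE ba offE; apply: eq_in_count => z zS /=.
  rewrite dotZl ltr_pM2l // -ltNge.
  by apply/idP/idP => [/(lt_trans at_) //|/(mmin z zS)]; apply: lt_le_trans.
have := win b; rewrite votes_ab votes_ba.
by move: cC shallow; rewrite size_S; lia.
Qed.

End Plane.

(** * Winning points and common points of the perfect lines *)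

Local Open Scope fset_scope.

Theorem theorem5 (R : realType) (S : {fset 'rV[R]_2})
    (S_even : ~~ odd #|` S|) :
  [/\ alice_wins S <-> (exists x : 'rV[R]_2, on_all_perfect_lines S x),
      (exists x : 'rV[R]_2, on_all_perfect_lines S x) ->
        exists x : 'rV[R]_2, on_all_perfect_lines S x /\ winning_point S x
    & (S = fset0 \/ ~ collinear S) ->
        forall x : 'rV[R]_2, on_all_perfect_lines S x -> winning_point S x].
Proof.
have size_S : size S = (size S)./2.*2.
  by rewrite -[LHS]odd_double_half (negbTE S_even).
have win_all x : winning_point S x -> on_all_perfect_lines S x.
  move=> /(winning_pointP x size_S) deep; apply/on_all_perfect_linesE => u t _.
  by move=> b; apply: (depth_on_balanced size_S deep b).
have all_win : S = fset0 \/ ~ collinear S ->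
    forall x, on_all_perfect_lines S x -> winning_point S x.
  move=> [->|ncol] x; first by move=> _ b; rewrite !votesE.
  move=> /on_all_perfect_linesE xall; apply/(winning_pointP x size_S).
  apply: (on_balanced_depth size_S xall) => w t w0.
  apply: contrapT => none; apply: ncol; exists (Line t w0) => y yS.
  rewrite /on_line subr_eq0; apply: contrapT => /negP yw.
  by apply: none; exists y.
have ex_win : (exists x, on_all_perfect_lines S x) ->
    exists x, on_all_perfect_lines S x /\ winning_point S x.
  move=> [x xall].
  have [S0|S0] := eqVneq S fset0.
    by exists x; split=> //; apply: all_win => //; left.
  have [[l lS]|ncol] := pselect (collinear S); last first.
    by exists x; split=> //; apply: all_win => //; right.
  have kpos : (0 < (size S)./2)%N.
    by rewrite -double_gt0 -size_S cardfs_gt0.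
  (* Here [x] itself may fail to win; a median point of [S] replaces it. *)
  have [y yS|m deep] := collinear_depth size_S (normal_neq0 l) kpos (t := offset l).
    by apply/eqP; rewrite -subr_eq0; apply: lS.
  have mwin : winning_point S m by apply/(winning_pointP m size_S).
  by exists m; split=> //; apply: win_all.
split=> //; split=> [[a awin]|/ex_win[a [_ awin]]]; exists a => //.
exact: win_all.
Qed.
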